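(* Given a probability distribution $P = p_1, \ldots, p_n$, we can construct a data structure that uses $2n + o(n)$ bits of space and supports a query that, given $i$ between $1$ and $n$, returns $q_i$ in $O(\log(1/q_i))$ time. Here, $Q = q_1, \ldots, q_n$ is a probability distribution with $\max_{1 \leq i \leq n} \{p_i / q_i\} < 4$, so $D(P \| Q) < 2$ and $O(\log(1/q_i)) \subseteq O(\log(1/p_i))$.
   Context: A probability distribution $P = p_1, \ldots, p_n$ is simply a (finite, ordered) sequence of non-negative real numbers that sum to $1$; the sample space is not stored. $\log$ means $\log_2$. The relative entropy of $P$ with respect to $Q$ is $D(P \| Q) = \sum_{i=1}^n p_i \log \frac{p_i}{q_i}$ (terms with $p_i = 0$ contribute $0$). The distribution $Q$ depends on $P$ only (not on the query), and the query is answered from the stored data structure without decompressing it. Time is the number of elementary steps of the query algorithm.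
   Formalization: The last inclusion is stated as O(log(1/q_i)) ⊆ O(1 + log(1/p_i)), since without the constant it fails as p_i tends to 1 with n ≥ 2; the O-bounds are required only for n ≥ 2, since for n = 1 log(1/q_1) = 0 and no query takes zero time. *)

(* Defs.v *)
From HB Require Import structures.
From mathcomp Require Import all_boot all_order all_algebra.
From mathcomp Require Import all_classical all_reals all_analysis.

Set Implicit Arguments.
Unset Strict Implicit.
Unset Printing Implicit Defensive.

Import Order.TTheory GRing.Theory Num.Theory. Import numFieldNormedType.Exports.

Local Open Scope ring_scope.

(** * Probability distributions *)

Record pdistr (R : realType) (n : nat) := PDistr {
  prob :> 'I_n -> R;
  prob_ge0 : forall i, 0 <= prob i;
  prob_sum1 : \sum_(i < n) prob i = 1
}.

Definition log2 {R : realType} (x : R) : R := ln x / ln 2.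

(* Terms with [p i = 0] vanish because of the factor [p i]. *)
Definition relative_entropy (R : realType) (n : nat) (p q : 'I_n -> R) : R :=
  \sum_(i < n) p i * log2 (p i / q i).

(* log (1 / x), with log (1 / 0) = +oo. *)
Definition log2_inv {R : realType} (x : R) : \bar R :=
  if x == 0 then +oo%E else (log2 x^-1)%:E.

(** * Asymptotics *)

(* The set O(g) of cost functions on instances (n, P, i), with one constant for
   all instances.  Only n >= 2 matters: for n = 1 there is a single instance,
   and log (1 / q_1) = 0 there. *)
Definition Oset (R : realType)
    (g : forall n, pdistr R n -> 'I_n -> \bar R) :
    set (forall n, pdistr R n -> 'I_n -> R) :=
  [set f | exists2 C : R, 0 < C &
    forall n (P : pdistr R n) (i : 'I_n), (1 < n)%N ->
      ((f n P i)%:E <= C%:E * g n P i)%E].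

(* f(n) = o(n) *)
Definition sublinear (R : realType) (f : nat -> nat) : Prop :=
  (((f n)%:R / n%:R : R) @[n --> \oo] --> (0 : R))%classic.

(** * The word RAM

    A program has registers, each holding a [w]-bit word, and read-only access
    to the stored bit string, as a sequence of [w]-bit words.  There is no
    other working memory, so that a fixed program needs O(w) bits in addition
    to the stored string. *)

Inductive binop := Add | Sub | Mul | Div | Mod | And | Or | Xor | Shl | Shr.

Inductive instr :=
  | Const (r k : nat)               (* r := k *)
  | Op (o : binop) (r x y : nat)    (* r := x o y *)
  | Read (r a : nat)                (* r := the stored word at address a *)
  | Jump (l : nat)
  | JumpEq (x y l : nat)            (* if x = y then goto l *)
  | JumpLt (x y l : nat)            (* if x < y then goto l *)
  | Return (a b s : nat).

Definition program := seq instr.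

(* Results are reduced modulo 2 ^ w; division by 0 gives 0. *)
Definition eval_binop (w : nat) (o : binop) (x y : nat) : nat :=
  (match o with
   | Add => x + y
   | Sub => x + (2 ^ w - y)
   | Mul => x * y
   | Div => x %/ y
   | Mod => x %% y
   | And => Nat.land x y
   | Or => Nat.lor x y
   | Xor => Nat.lxor x y
   | Shl => x * 2 ^ y
   | Shr => x %/ 2 ^ y
   end %% 2 ^ w)%N.

(* Least significant bit first; bits past the end of [s] read as 0. *)
Definition stored_word (w : nat) (s : seq bool) (k : nat) : nat :=
  (\sum_(j < w) nth false s (k * w + j) * 2 ^ j)%N.

Definition set_reg (reg : nat -> nat) (r v : nat) : nat -> nat :=
  fun x => if x == r then v else reg x.

Definition step (w : nat) (s : seq bool) (c : instr)
    (pc : nat) (reg : nat -> nat) : nat * (nat -> nat) :=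
  match c with
  | Const r k => (pc.+1, set_reg reg r (k %% 2 ^ w)%N)
  | Op o r x y => (pc.+1, set_reg reg r (eval_binop w o (reg x) (reg y)))
  | Read r a => (pc.+1, set_reg reg r (stored_word w s (reg a)))
  | Jump l => (l, reg)
  | JumpEq x y l => (if reg x == reg y then l else pc.+1, reg)
  | JumpLt x y l => (if (reg x < reg y)%N then l else pc.+1, reg)
  | Return _ _ _ => (pc, reg)
  end.

(* [run w s prog t pc reg] is the triple of words returned by the execution
   started at [pc] with registers [reg], if it returns in exactly [t] steps
   (the final [Return] included). *)
Fixpoint run (w : nat) (s : seq bool) (prog : program)
    (t pc : nat) (reg : nat -> nat) : option (nat * nat * nat) :=
  match t, onth prog pc with
  | 1, Some (Return a b e) => Some (reg a, reg b, reg e)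
  | _.+1, (Some (Return _ _ _) | None) => None
  | t'.+1, Some c =>
      let: (pc', reg') := step w s c pc reg in run w s prog t' pc' reg'
  | 0, _ => None
  end.

(* The value returned through words a, b, e is (a / b) * 2 ^ -e: a probability
   may be smaller than 2 ^ -w, hence the exponent. *)
Definition answers (R : realType) (w : nat) (s : seq bool) (prog : program)
    (x t : nat) (v : R) : Prop :=
  exists a b e : nat,
    run w s prog t 0 (set_reg (fun=> 0%N) 0 x) = Some (a, b, e) /\
    v = a%:R / b%:R / 2 ^+ e.

(* Words of Theta(log n) bits; trunc_log 2 n is the floor of log n. *)
Definition word_size (c n : nat) : nat := (c * (trunc_log 2 n).+1)%N.

(* Main.v *)
Require Import Defs.
From HB Require Import structures.
From mathcomp Require Import all_boot all_order all_algebra.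
From mathcomp Require Import all_classical all_reals all_analysis.
From mathcomp Require Import zify ring lra.

Set Implicit Arguments.
Unset Strict Implicit.
Unset Printing Implicit Defensive.

Import Order.TTheory GRing.Theory Num.Theory.

Local Open Scope nat_scope.

(* Put x_i = n p_i, let k_i = 0 if x_i < 1 and k_i = floor(log2 x_i) + 1 otherwise,
   and let q_i = 2^k_i / S with S = sum_i 2^k_i.  Since x_i < 2^k_i <= 2 x_i + 1, we
   get S <= 3n and p_i / q_i < 3; since k_i <= x_i, the unary codes 0^k_i 1 of the
   levels k_i take at most 2n bits altogether.

   A query has to find k_i.  Items of large probability are found in a complete
   binary tree of depth D slightly below log2 n: its nodes are the dyadic intervals
   of the cumulative distribution of Q, and a node stores the item that contains the
   midpoint of its interval.  An item not met above depth d lies inside a dyadic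
   interval of length 2^-d, hence q_i <= 2^-d, so the descent takes O(log(1/q_i)) steps.
   Items not met in the tree have q_i <= 2^-D, for which O(log n) steps are allowed.
   Their levels are O(s), where s is about the fourth root of log n, and are read
   bit by bit from the unary codes truncated to O(s): with one absolute pointer per
   s^5 items, and the offsets of the blocks of s^3 items packed s^2 to a word,
   only O(s^4) = O(log n) bits have to be scanned.  All of this apart from the unary
   codes takes O(n / s) bits. *)

(** * Straight-line execution of the word RAM *)

Definition is_return (c : instr) : bool := if c is Return _ _ _ then true else false.

(* [step] on register files given by lists, so that a symbolic run computes. *)
Definition list_step (w : nat) (s : seq bool) (c : instr) (pc : nat) (l : seq nat) :
    nat * seq nat :=
  match c with
  | Const r k => (pc.+1, set_nth 0 l r (k %% 2 ^ w))
  | Op o r x y => (pc.+1, set_nth 0 l r (eval_binop w o (nth 0 l x) (nth 0 l y)))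
  | Read r a => (pc.+1, set_nth 0 l r (stored_word w s (nth 0 l a)))
  | Jump l' => (l', l)
  | JumpEq x y l' => (if nth 0 l x == nth 0 l y then l' else pc.+1, l)
  | JumpLt x y l' => (if nth 0 l x < nth 0 l y then l' else pc.+1, l)
  | Return _ _ _ => (pc, l)
  end.

Lemma set_reg_nth (l : seq nat) (r v : nat) :
  set_reg (nth 0 l) r v = nth 0 (set_nth 0 l r v).
Proof. by apply/funext => x; rewrite nth_set_nth /set_reg /=. Qed.

(** [B] is only an upper bound on the steps, so that bounds can be rounded up between program
    fragments. *)
Definition halts (w : nat) (s : seq bool) (prog : program) (B pc : nat) (l : seq nat)
    (res : nat * nat * nat) : Prop :=
  exists2 t, t <= B & run w s prog t pc (nth 0 l) = Some res.

Lemma halts_step w s prog c B pc l res :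
  onth prog pc = Some c -> ~~ is_return c ->
  halts w s prog B (list_step w s c pc l).1 (list_step w s c pc l).2 res ->
  halts w s prog B.+1 pc l res.
Proof.
move=> Ec Nc [t tB Ht]; exists t.+1 => //.
have -> : run w s prog t.+1 pc (nth 0 l) =
    (let: (pc', reg') := step w s c pc (nth 0 l) in run w s prog t pc' reg').
  by rewrite /= Ec; case: (c) Nc => //=; case: t {tB Ht}.
by rewrite -Ht; case: (c) => //= *; rewrite set_reg_nth.
Qed.

Lemma halts_return w s prog B pc l a b e res :
  onth prog pc = Some (Return a b e) -> (nth 0 l a, nth 0 l b, nth 0 l e) = res ->
  halts w s prog B.+1 pc l res.
Proof. by move=> E <-; exists 1 => //=; rewrite E. Qed.

Lemma halts_leq w s prog B B' pc l res :
  halts w s prog B pc l res -> B <= B' -> halts w s prog B' pc l res.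
Proof. by move=> [t tB H] BB; exists t => //; apply: leq_trans BB. Qed.

Lemma eval_add w x y : x + y < 2 ^ w -> eval_binop w Add x y = x + y.
Proof. exact: modn_small. Qed.

Lemma eval_sub w x y : y <= x -> x < 2 ^ w -> eval_binop w Defs.Sub x y = x - y.
Proof.
move=> yx xw; rewrite /eval_binop addnBA; last exact: leq_trans (ltnW xw).
by rewrite addnC -addnBA // modnDl modn_small // (leq_ltn_trans (leq_subr _ _)).
Qed.

Lemma eval_mul w x y : x * y < 2 ^ w -> eval_binop w Mul x y = x * y.
Proof. exact: modn_small. Qed.

Lemma eval_div w x y : x < 2 ^ w -> eval_binop w Div x y = x %/ y.
Proof. by move=> xw; apply/modn_small/(leq_ltn_trans _ xw)/leq_div. Qed.

Lemma eval_mod w x y : x < 2 ^ w -> eval_binop w Mod x y = x %% y.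
Proof. by move=> xw; apply/modn_small/(leq_ltn_trans _ xw)/leq_mod. Qed.

Lemma eval_shr w x y : x < 2 ^ w -> eval_binop w Shr x y = x %/ 2 ^ y.
Proof. exact: eval_div. Qed.

Arguments eval_binop : simpl never.
Arguments stored_word : simpl never.
Arguments run : simpl never.

(** * Bit strings *)

Lemma sum_binary_digits w v : \sum_(j < w) odd (v %/ 2 ^ j) * 2 ^ j = v %% 2 ^ w.
Proof.
elim: w v => [|w IH] v; first by rewrite big_ord0 modn1.
rewrite big_ord_recl /= divn1 muln1.
under eq_bigr => i _ do rewrite /bump /= add1n expnS divnMA mulnA (mulnC _ 2) -mulnA.
rewrite -big_distrr /= IH.
set q := v %/ 2; have q1 := ltn_pmod q (expn_gt0 2 w).
have Ev : v = q %/ 2 ^ w * 2 ^ w.+1 + (odd v + 2 * (q %% 2 ^ w)).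
  by have := divn_eq q (2 ^ w); have := divn_eq v 2; rewrite modn2 expnS /q; nia.
by rewrite [in RHS]Ev modnMDl [in RHS]modn_small // expnS; case: odd; lia.
Qed.

(** The base [G] is 2 for the bits of a word and a power of 2 for the fields packed in a word. *)
Lemma sum_digits_bound G m (d : nat -> nat) : (forall j, j < m -> d j < G) ->
  \sum_(j < m) d j * G ^ j < G ^ m.
Proof.
elim: m => [|m IH] dG; first by rewrite big_ord0.
rewrite big_ord_recr /= expnS -addSn; apply: leq_trans (leq_add (IH _) (leqnn _)) _.
  by move=> j jm; apply/dG/leqW.
by rewrite -mulSn leq_mul2r dG ?orbT.
Qed.

Lemma sum_digits_nth G m (d : nat -> nat) j0 : (forall j, j < m -> d j < G) ->
  j0 < m -> (\sum_(j < m) d j * G ^ j) %/ G ^ j0 %% G = d j0.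
Proof.
elim: m d j0 => [|m IH] d j0 dG // jm.
have d0 : d 0 < G by exact: dG.
rewrite big_ord_recl /= muln1.
under eq_bigr => i _ do rewrite /bump /= add1n expnS mulnA (mulnC _ G) -mulnA.
rewrite -big_distrr /=; case: j0 jm => [|j0] jm.
  by rewrite divn1 addnC mulnC modnMDl modn_small.
rewrite expnS divnMA (addnC (d 0)) (mulnC G) divnMDl ?(leq_ltn_trans _ d0) // (divn_small d0).
rewrite -[RHS](IH (fun j => d j.+1)) //; first by congr ((_ %/ _) %% _); apply: addn0.
by move=> j jm'; apply: dG.
Qed.

Definition words_to_bits (w N : nat) (mem : nat -> nat) : seq bool :=
  mkseq (fun p => odd (mem (p %/ w) %/ 2 ^ (p %% w))) (N * w).

Lemma stored_word_mem w N mem u k : k < N -> mem k < 2 ^ w ->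
  stored_word w (words_to_bits w N mem ++ u) k = mem k.
Proof.
move=> kN mw; rewrite -[RHS](modn_small mw) -sum_binary_digits /stored_word.
apply: eq_bigr => j _; congr (nat_of_bool _ * _).
have jw := ltn_ord j.
have kw : k * w + j < N * w by nia.
rewrite nth_cat size_mkseq kw nth_mkseq // divnMDl ?modnMDl; last by lia.
by rewrite [j %/ w]divn_small // addn0 [j %% w]modn_small.
Qed.

Lemma stored_word_bit w s p : 0 < w ->
  stored_word w s (p %/ w) %/ 2 ^ (p %% w) %% 2 = nth false s p.
Proof.
move=> w0; pose d j : nat := nth false s (p %/ w * w + j).
rewrite /stored_word (@sum_digits_nth 2 w d) ?ltn_pmod //; last by rewrite /d => j _; case: nth.
by rewrite /d -divn_eq.
Qed.

Lemma stored_word_lt w s k : stored_word w s k < 2 ^ w.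
Proof. by apply: (@sum_digits_bound 2 w (fun j => nth false s (k * w + j))) => // j; case: nth. Qed.

Definition codeword (k : nat) : seq bool := rcons (nseq k false) true.

(** Cutting levels at [h] bounds the length of every block of codes; items above the cut are
    answered by the tree, so their codes only have to be skipped. *)
Definition stream (h : nat) (ks : seq nat) : seq bool :=
  flatten [seq codeword (minn k h) | k <- ks].

Lemma stream_cat h ks1 ks2 : stream h (ks1 ++ ks2) = stream h ks1 ++ stream h ks2.
Proof. by rewrite /stream map_cat flatten_cat. Qed.

Lemma size_stream_cap h ks : size (stream h ks) <= size ks * h.+1.
Proof.
elim: ks => //= k ks IH; rewrite /stream /= size_cat -/(stream h ks) size_rcons size_nseq.
rewrite mulSn; have := geq_minr k h; lia.
Qed.

Lemma size_stream_le h ks : size (stream h ks) <= \sum_(k <- ks) k.+1.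
Proof.
elim: ks => //= k ks IH; rewrite big_cons /stream /= size_cat -/(stream h ks).
rewrite size_rcons size_nseq; have := geq_minl k h; lia.
Qed.

Definition offset (h : nat) (ks : seq nat) (t : nat) : nat := size (stream h (take t ks)).

Lemma drop_stream h ks t : drop (offset h ks t) (stream h ks) = stream h (drop t ks).
Proof.
by rewrite -{2}(cat_take_drop t ks) stream_cat drop_size_cat.
Qed.

Lemma offsetD h ks t r : offset h ks (t + r) = offset h ks t + size (stream h (take r (drop t ks))).
Proof. by rewrite /offset takeD stream_cat size_cat. Qed.

Lemma offsetD_le h ks t r : offset h ks (t + r) - offset h ks t <= r * h.+1.
Proof.
rewrite offsetD addKn; apply: leq_trans (size_stream_cap _ _) _.
by rewrite leq_mul2r size_take; case: ltnP => /= ?; lia.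
Qed.

Lemma leq_offset h ks t : offset h ks t <= \sum_(k <- ks) k.+1.
Proof.
apply: leq_trans (size_stream_le _ _) _.
by rewrite -{2}(cat_take_drop t ks) big_cat leq_addr.
Qed.

(** * The data structure *)

Definition bitlen (n : nat) : nat := (trunc_log 2 n).+1.

(* A power of 2 within a factor 2 below the fourth root of [bitlen n]. *)
Definition root4 (n : nat) : nat := 2 ^ trunc_log 16 (bitlen n).

Lemma root4_gt0 n : 0 < root4 n.
Proof. by rewrite expn_gt0. Qed.

Lemma root4X n : root4 n ^ 4 = 16 ^ trunc_log 16 (bitlen n).
Proof. by rewrite /root4 -expnM mulnC expnM. Qed.

Lemma root4_le n : root4 n ^ 4 <= bitlen n.
Proof. by rewrite root4X; apply: trunc_logP. Qed.

Lemma root4_gt n : bitlen n < 16 * root4 n ^ 4.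
Proof. by rewrite root4X -expnS; apply: trunc_log_ltn. Qed.

Lemma ltn_bitlen n : n < 2 ^ bitlen n.
Proof. exact: trunc_log_ltn. Qed.

(** Since s^5 <= 2^(5s) for s = [root4 n], at most n / s^5 + 1 nodes remain, no more than the
    entries of the superblock directory. *)
Definition tree_depth (n : nat) : nat := trunc_log 2 n - 5 * root4 n.

(** An item missed by the tree has 2^(k + D) <= S <= 3n, so k <= 5s + 2 <= 7s. *)
Definition max_level (n : nat) : nat := 7 * root4 n.

Definition weight_before (ks : seq nat) (t : nat) : nat := \sum_(k <- take t ks) 2 ^ k.

Definition total_weight (ks : seq nat) : nat := \sum_(k <- ks) 2 ^ k.

(** Measured in units of weight; rounding down is harmless because the result is only compared with
    integral prefix sums. *)
Definition midpoint (ks : seq nat) (v : nat) : nat :=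
  let d := trunc_log 2 v in ((2 * (v - 2 ^ d) + 1) * total_weight ks) %/ 2 ^ d.+1.

(* Node [v] of the tree in heap order, at depth [d], stands for the interval
   [u / 2 ^ d, (u + 1) / 2 ^ d) of the cumulative distribution, [u = v - 2 ^ d];
   its splitter is the item whose interval contains the midpoint. *)
Definition splitter (ks : seq nat) (v : nat) : nat :=
  find (fun j => midpoint ks v < weight_before ks j.+1) (iota 0 (size ks)).

(** Wide enough for s^5 codes of at most 7s + 1 bits, while s^2 fields still fit in a word: 9 s^3 <=
    9 s^4 <= 16 [bitlen n]. *)
Definition field_width (n : nat) : nat := 9 * root4 n.

Definition block_offset (ks : seq nat) (t : nat) : nat := offset (max_level (size ks)) ks t.

(* The starts of the [s ^ 2] blocks of superblock [b], relative to the start of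
   the superblock, packed in one word. *)
Definition relative_offsets (ks : seq nat) (b : nat) : nat :=
  let s := root4 (size ks) in
  \sum_(j < s ^ 2)
    (block_offset ks (b * s ^ 5 + j * s ^ 3) - block_offset ks (b * s ^ 5)) *
    (2 ^ field_width (size ks)) ^ j.

Definition directory_base (n : nat) : nat := 8 + 2 * 2 ^ tree_depth n.

Definition word_count (n : nat) : nat := directory_base n + 2 * (n %/ root4 n ^ 5).+1.

Definition header (ks : seq nat) : seq nat :=
  let n := size ks in
  [:: 2 ^ tree_depth n; total_weight ks; word_size 16 n; root4 n ^ 3; root4 n ^ 2;
      field_width n; 2 ^ field_width n; directory_base n].

(** Both tables start at even addresses, so parity separates the two words of an entry. Splitters
    are numbered from 1, like the argument of the query. Pointers are absolute bit positions, the
    stream being stored after all the words. *)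
Definition memory (ks : seq nat) (a : nat) : nat :=
  let n := size ks in
  if a < 8 then nth 0 (header ks) a
  else if a < directory_base n then
    let j := splitter ks ((a - 8) %/ 2) in if odd a then 2 ^ nth 0 ks j else j.+1
  else
    let b := (a - directory_base n) %/ 2 in
    if odd a then relative_offsets ks b
    else word_count n * word_size 16 n + block_offset ks (b * root4 n ^ 5).

Definition encode (ks : seq nat) : seq bool :=
  words_to_bits (word_size 16 (size ks)) (word_count (size ks)) (memory ks)
  ++ stream (max_level (size ks)) ks.

(* r0 holds the argument, r1 = 1, r2 = 0, r3 = 2 ^ tree_depth n and r4 is the total
   weight; the comments give the addresses of jump targets. *)
Definition query : program := [::
  Const 1 1; Read 3 2; Read 4 1; Const 5 1; Const 8 8;
  (* 5: descent in the tree, at node r5 *)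
  JumpLt 5 3 7; Jump 17;
  Op Add 5 5 5; Op Add 6 5 8; Read 7 6; JumpEq 7 0 14;
  JumpLt 0 7 5; Op Add 5 5 1; Jump 5;
  (* 14: r0 is the splitter *)
  Op Add 6 6 1; Read 7 6; Return 7 4 2;
  (* 17: position r5 of the block of r0, remaining index r9 in the block *)
  Op Defs.Sub 0 0 1;
  Const 6 2; Read 11 6; Const 6 3; Read 12 6; Const 6 4; Read 13 6;
  Const 6 5; Read 14 6; Const 6 6; Read 15 6; Const 6 7; Read 16 6;
  Op Mod 9 0 12; Op Div 0 0 12; Op Mod 7 0 13; Op Div 0 0 13;
  Op Add 0 0 0; Op Add 0 0 16; Read 5 0; Op Add 0 0 1; Read 0 0;
  Op Mul 7 7 14; Op Shr 0 0 7; Op Mod 0 0 15; Op Add 5 5 0;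
  Const 10 1; Const 8 2;
  (* 45: bit by bit decoding, with the current weight in r10 *)
  Op Div 6 5 11; Op Mod 7 5 11; Read 6 6; Op Shr 6 6 7; Op Mod 6 6 8;
  Op Add 5 5 1; JumpEq 6 1 54; Op Add 10 10 10; Jump 45;
  JumpEq 9 2 58; Op Defs.Sub 9 9 1; Const 10 1; Jump 45;
  Return 10 4 2].

(** * Correctness of the query *)

Lemma weight_before_S ks i : i < size ks ->
  weight_before ks i.+1 = weight_before ks i + 2 ^ nth 0 ks i.
Proof.
by move=> ik; rewrite /weight_before (take_nth 0 ik) -cats1 big_cat big_seq1.
Qed.

Lemma weight_before_size ks : weight_before ks (size ks) = total_weight ks.
Proof. by rewrite /weight_before take_size. Qed.

Lemma leq_weight_before ks i j : i <= j -> weight_before ks i <= weight_before ks j.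
Proof.
by move=> ij; rewrite /weight_before -(subnKC ij) takeD big_cat leq_addr.
Qed.

Lemma size_leq_total_weight ks : size ks <= total_weight ks.
Proof.
elim: ks => //= k ks IH; rewrite /total_weight big_cons -/(total_weight ks).
by have := expn_gt0 2 k; lia.
Qed.

Lemma trunc_log_node d u : u < 2 ^ d -> trunc_log 2 (2 ^ d + u) = d.
Proof. by move=> ud; apply: trunc_log_eq => //; rewrite expnS; lia. Qed.

(** The first prefix sum above the midpoint gives the strict bound; the failure of the test just
    before it gives the other one. *)
Lemma splitterP ks d u : 0 < size ks -> u < 2 ^ d ->
  let j := splitter ks (2 ^ d + u) in
  [/\ j < size ks,
      weight_before ks j * 2 ^ d.+1 <= (2 * u + 1) * total_weight ks &
      (2 * u + 1) * total_weight ks < weight_before ks j.+1 * 2 ^ d.+1].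
Proof.
move=> n0 ud /=; have S0 : 0 < total_weight ks := leq_trans n0 (size_leq_total_weight ks).
set M := midpoint ks (2 ^ d + u).
have EM : M = (2 * u + 1) * total_weight ks %/ 2 ^ d.+1.
  by rewrite /M /midpoint trunc_log_node // addKn.
have MS : M < total_weight ks.
  by rewrite EM ltn_divLR ?expn_gt0 // mulnC ltn_pmul2l // expnS; lia.
rewrite /splitter -/M; set f := (X in find X).
have hf : has f (iota 0 (size ks)).
  apply/hasP; exists (size ks).-1; first by rewrite mem_iota; lia.
  by rewrite /f prednK // weight_before_size.
have jn : find f (iota 0 (size ks)) < size ks by rewrite -[X in _ < X](size_iota 0) -has_find.
have := nth_find 0 hf; rewrite nth_iota // add0n {1}/f => Mj.
split=> //; last by rewrite -ltn_divLR ?expn_gt0 // -EM.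
case Ej : (find f (iota 0 (size ks))) => [|j]; first by rewrite /weight_before take0 big_nil.
have := @before_find _ 0 f (iota 0 (size ks)) j; rewrite Ej => /(_ (ltnSn j)).
rewrite nth_iota; last by lia.
by rewrite add0n /f => /negbT; rewrite -leqNgt EM leq_divRL ?expn_gt0.
Qed.

(** * Word-size and overflow bounds *)

Lemma word_bound n : 300 * (2 ^ bitlen n) ^ 2 < 2 ^ word_size 16 n.
Proof.
rewrite /word_size -/(bitlen n) [16 * _]mulnC [X in _ < X]expnM.
have : 2 ^ 1 <= 2 ^ bitlen n by rewrite leq_exp2l.
move: (2 ^ bitlen n) => X X2.
(* With X = 2 ^ [bitlen n], words hold numbers below X^16, and X^14 >= 2^14 > 300. Bit positions
   stay below 224 X^2 plus a multiple of X. *)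
have -> : X ^ 16 = X ^ 14 * X ^ 2 by rewrite -expnD.
rewrite ltn_pmul2r ?expn_gt0; last by lia.
have : 2 ^ 14 <= X ^ 14 by rewrite leq_exp2r.
by apply: leq_trans.
Qed.

Lemma expn_tree_depth_le n : 0 < n -> 2 ^ tree_depth n <= n.
Proof.
move=> n0; apply: leq_trans (trunc_logP (ltnSn 1) n0).
by rewrite leq_exp2l // leq_subr.
Qed.

Lemma word_count_le n : 0 < n -> word_count n <= 14 * 2 ^ bitlen n.
Proof.
move=> n0; rewrite /word_count /directory_base.
have := expn_tree_depth_le n0; have := ltn_bitlen n; have := leq_div n (root4 n ^ 5).
by lia.
Qed.

Lemma bit_count_le n : 0 < n -> word_count n * word_size 16 n <= 224 * (2 ^ bitlen n) ^ 2.
Proof.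
move=> n0; rewrite (_ : 224 = 14 * 16) // -mulnn -mulnA (mulnCA 16) mulnA leq_mul //.
  exact: word_count_le.
by rewrite leq_mul2l /= ltnW // ltn_expl.
Qed.

Lemma field_width_bound n : root4 n ^ 2 * root4 n ^ 3 * (max_level n).+1 < 2 ^ field_width n.
Proof.
rewrite /max_level /field_width; move: (root4 n) (root4_gt0 n) => s s0.
have s2 : s < 2 ^ s by apply: ltn_expl.
have -> : s ^ 2 * s ^ 3 = s ^ 5 by rewrite -expnD.
have -> : 2 ^ (9 * s) = (2 ^ s) ^ 5 * (2 ^ s * 2 ^ (3 * s)).
  by rewrite -expnM -!expnD; congr (_ ^ _); lia.
rewrite ltn_mul ?ltn_exp2r //.
have : 2 ^ 3 <= 2 ^ (3 * s) by rewrite leq_exp2l // leq_pmulr.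
by move=> /(leq_mul s2); apply: leq_trans; lia.
Qed.

Lemma relative_offset_lt ks b j : j < root4 (size ks) ^ 2 ->
  let s := root4 (size ks) in
  block_offset ks (b * s ^ 5 + j * s ^ 3) - block_offset ks (b * s ^ 5)
  < 2 ^ field_width (size ks).
Proof.
move=> js /=; apply: leq_ltn_trans (offsetD_le _ _ _ _) _.
apply: leq_ltn_trans (field_width_bound _).
by rewrite !leq_mul2r ltnW ?orbT.
Qed.

Lemma relative_offsets_lt ks b : relative_offsets ks b < 2 ^ word_size 16 (size ks).
Proof.
rewrite /relative_offsets; set n := size ks; set s := root4 n.
pose d j := block_offset ks (b * s ^ 5 + j * s ^ 3) - block_offset ks (b * s ^ 5).
apply: leq_trans (@sum_digits_bound (2 ^ field_width n) (s ^ 2) d _) _.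
  by move=> j /relative_offset_lt; apply.
rewrite -expnM leq_exp2l // /field_width /word_size -/(bitlen n) -/s.
have := root4_le n; have := root4_gt0 n; rewrite -/s => s0.
rewrite -mulnA -expnS => sL; apply: leq_trans (_ : 9 * s ^ 4 <= _); last by lia.
by rewrite leq_mul2l leq_pexp2l.
Qed.

Lemma relative_offsets_digit ks b j : j < root4 (size ks) ^ 2 ->
  let s := root4 (size ks) in
  relative_offsets ks b %/ 2 ^ (field_width (size ks) * j) %% 2 ^ field_width (size ks) =
  block_offset ks (b * s ^ 5 + j * s ^ 3) - block_offset ks (b * s ^ 5).
Proof.
move=> js /=; rewrite expnM /relative_offsets; set n := size ks; set s := root4 n.
pose d j := block_offset ks (b * s ^ 5 + j * s ^ 3) - block_offset ks (b * s ^ 5).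
by apply: (@sum_digits_nth (2 ^ field_width n) (s ^ 2) d) => // k /relative_offset_lt; apply.
Qed.

(** The interface between the real distribution and the combinatorial part: the second clause is the
    2n-bit budget of the unary codes, the third bounds the normalizing factor of Q. *)
Definition admissible (ks : seq nat) : Prop :=
  [/\ 0 < size ks, \sum_(k <- ks) k.+1 <= 2 * size ks & total_weight ks <= 3 * size ks].

Lemma weight_le ks i : i < size ks -> 2 ^ nth 0 ks i <= total_weight ks.
Proof.
move=> ik; rewrite -(weight_before_size ks).
by apply: leq_trans (leq_weight_before ks ik); rewrite weight_before_S // leq_addl.
Qed.

Lemma memory_lt ks a : admissible ks -> memory ks a < 2 ^ word_size 16 (size ks).
Proof.
move=> [n0 H1 H2]; set n := size ks in n0 H1 H2 *.
have nL := ltn_bitlen n; have LX : bitlen n < 2 ^ bitlen n by apply: ltn_expl.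
have XX : 2 ^ bitlen n <= (2 ^ bitlen n) ^ 2 by rewrite -[X in X <= _]expn1 leq_pexp2l ?expn_gt0.
have wb := word_bound n; have bc := bit_count_le n0; have wc := word_count_le n0.
have dn := expn_tree_depth_le n0.
have sb := relative_offsets_lt ks; have s4 := root4_le n; have s0 := root4_gt0 n.
rewrite /memory -/n; case: (ltnP a 8) => [a8|_].
  have s3 : root4 n ^ 3 <= root4 n ^ 4 by rewrite leq_pexp2l.
  have s2 : root4 n ^ 2 <= root4 n ^ 4 by rewrite leq_pexp2l.
  have s1 : root4 n ^ 1 <= root4 n ^ 4 by rewrite leq_pexp2l.
  have fw : field_width n < word_size 16 n.
    by rewrite /field_width /word_size -/(bitlen n); lia.
  have fw2 : 2 ^ field_width n < 2 ^ word_size 16 n by rewrite ltn_exp2l.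
  have fw3 : field_width n < 2 ^ field_width n by apply: ltn_expl.
  have ww : word_size 16 n < 2 ^ word_size 16 n by apply: ltn_expl.
  have db : directory_base n <= word_count n by apply: leq_addr.
  by case: a a8 => [|[|[|[|[|[|[|[|//]]]]]]]] _; rewrite /= -?/n; lia.
case: (ltnP a (directory_base n)) => _.
  case: ifP => _; last first.
    have : splitter ks ((a - 8) %/ 2) <= n.
      by rewrite /splitter (leq_trans (find_size _ _)) // size_iota.
    by lia.
  have : 2 ^ nth 0 ks (splitter ks ((a - 8) %/ 2)) <= 3 * n; last by lia.
  case: (ltnP (splitter ks ((a - 8) %/ 2)) n) => [jn|nj].
    exact: leq_trans (weight_le jn) _.
  by rewrite nth_default //; lia.
case: ifP => _ //.
have := leq_offset (max_level n) ks ((a - directory_base n) %/ 2 * root4 n ^ 5).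
rewrite -/n /block_offset -/n; lia.
Qed.

(** * Symbolic execution and decoding of the unary codes *)

Ltac exec := eapply halts_step; [reflexivity | reflexivity | rewrite /list_step /=].

(** These six instructions are shared by both outcomes of the bit test. The continuation allows any
    [r7'], as the scratch register 7 is overwritten before it is read again. *)
Lemma step_bit w enc x NB S p r6 r7 u y A m g G b B res :
  0 < w -> 1 < 2 ^ w -> size enc < 2 ^ w -> p < size enc ->
  (forall r7', halts w enc query B 51
     [:: x; 1; 0; NB; S; p.+1; nth false enc p : nat; r7'; 2; u; y; w; A; m; g; G; b] res) ->
  halts w enc query B.+4.+2 45
     [:: x; 1; 0; NB; S; p; r6; r7; 2; u; y; w; A; m; g; G; b] res.
Proof.
move=> w0 w1 ew pe H; have pw : p < 2 ^ w by apply: ltn_trans ew.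
exec; rewrite eval_div //; exec; rewrite eval_mod //; exec.
exec; rewrite eval_shr ?stored_word_lt //; exec; rewrite eval_mod; last first.
  by apply: leq_ltn_trans (leq_div _ _) (stored_word_lt _ _ _).
rewrite stored_word_bit //; exec; rewrite eval_add addn1; first exact: H.
exact: leq_ltn_trans ew.
Qed.

(** Each 0 costs nine steps and doubles the weight in register 10; the closing 1 costs seven steps
    and leaves the loop. *)
Lemma decode_zeros w enc x NB S p r6 r7 u y A m g G b k rest B res :
  0 < w -> 1 < 2 ^ w -> size enc < 2 ^ w ->
  p <= size enc -> drop p enc = nseq k false ++ true :: rest -> y * 2 ^ k < 2 ^ w ->
  (forall r7', halts w enc query B 54
     [:: x; 1; 0; NB; S; p + k.+1; 1; r7'; 2; u; y * 2 ^ k; w; A; m; g; G; b] res) ->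
  halts w enc query (9 * k + 7 + B) 45
     [:: x; 1; 0; NB; S; p; r6; r7; 2; u; y; w; A; m; g; G; b] res.
Proof.
move=> w0 w1 ew; elim: k p r6 r7 y => [|k IH] p r6 r7 y pe dp yw H.
  have pe' : p < size enc by rewrite ltnNge; apply/negP => /drop_oversize; rewrite dp.
  have bp : nth false enc p = true by rewrite -[p]addn0 -nth_drop dp.
  have -> : 9 * 0 + 7 + B = B.+1.+4.+2 by lia.
  apply: step_bit => // r7'.
  rewrite bp; exec.
  by have := H r7'; rewrite addn1 muln1.
have pe' : p < size enc by rewrite ltnNge; apply/negP => /drop_oversize; rewrite dp.
have bp : nth false enc p = false by rewrite -[p]addn0 -nth_drop dp.
have -> : 9 * k.+1 + 7 + B = (9 * k + 7 + B).+3.+4.+2 by lia.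
apply: step_bit => // r7'; rewrite bp; exec; exec; rewrite eval_add; last first.
  by apply: leq_ltn_trans yw; rewrite expnS; have := expn_gt0 2 k; nia.
exec; apply: IH => //.
- by rewrite -add1n -drop_drop dp /= drop0.
- by rewrite addnn -mul2n -mulnA mulnCA -expnS.
by move=> r8; rewrite addnn -mul2n -mulnA mulnCA -expnS addSnnS.
Qed.

(** Items before [u] are skipped by decoding them: a codeword costs at most 9h + 7 steps, and four
    more restart the loop with weight 1. *)
Lemma decode_stream w enc x NB S p r6 r7 u A m g G b h ks :
  0 < w -> 1 < 2 ^ w -> size enc < 2 ^ w -> h < w ->
  p <= size enc -> drop p enc = stream h ks -> u < size ks -> u < 2 ^ w ->
  halts w enc query (u.+1 * (9 * h + 11)) 45
     [:: x; 1; 0; NB; S; p; r6; r7; 2; u; 1; w; A; m; g; G; b]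
     (2 ^ minn (nth 0 ks u) h, S, 0).
Proof.
move=> w0 w1 ew hw; elim: u p r6 r7 ks => [|u IH] p r6 r7 [|k ks] //= pe dp us uw.
  apply: (@halts_leq _ _ _ (9 * minn k h + 7 + 2)); last by have := geq_minr k h; lia.
  apply: (@decode_zeros _ _ _ _ _ _ _ _ _ _ _ _ _ _ _ _ (stream h ks)) => //.
  - by rewrite dp /stream /= /codeword cat_rcons.
  - by rewrite mul1n ltn_exp2l // (leq_ltn_trans _ hw) // geq_minr.
  by move=> r7'; exec; rewrite mul1n; eapply halts_return; reflexivity.
have dp' : drop p enc = nseq (minn k h) false ++ true :: stream h ks.
  by rewrite dp /stream /= /codeword cat_rcons.
apply: (@halts_leq _ _ _ (9 * minn k h + 7 + (u.+1 * (9 * h + 11)).+4)); last first.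
  by have := geq_minr k h; lia.
apply: (@decode_zeros _ _ _ _ _ _ _ _ _ _ _ _ _ _ _ _ (stream h ks)) => //.
  by rewrite mul1n ltn_exp2l // (leq_ltn_trans _ hw) // geq_minr.
move=> r7'; exec; exec; rewrite eval_sub // subn1 /=; exec; rewrite modn_small //; exec.
have dp2 : drop (p + (minn k h).+1) enc = stream h ks.
  by rewrite addnC -drop_drop dp' -cat_rcons drop_size_cat // size_rcons size_nseq.
apply: IH => //; last exact: ltnW.
have := congr1 size dp'; rewrite size_drop size_cat size_nseq /=; lia.
Qed.

(** * Contents of the stored words *)

Lemma header_words_lt n : 8 <= word_count n.
Proof. by rewrite /word_count /directory_base -addnA leq_addr. Qed.

Lemma memory_splitter ks v : v < 2 ^ tree_depth (size ks) ->
  memory ks (2 * v + 8) = (splitter ks v).+1.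
Proof.
move=> vD; rewrite /memory ltnNge leq_addl /= [_ + 8]addnC /directory_base.
rewrite ltn_add2l ltn_pmul2l // vD.
by rewrite oddD oddM /= addKn mulKn.
Qed.

Lemma memory_weight ks v : v < 2 ^ tree_depth (size ks) ->
  memory ks (2 * v + 9) = 2 ^ nth 0 ks (splitter ks v).
Proof.
move=> vD; rewrite /memory /directory_base.
have -> : (2 * v + 9 < 8) = false by lia.
have -> : 2 * v + 9 < 8 + 2 * 2 ^ tree_depth (size ks) by lia.
have -> : odd (2 * v + 9) by lia.
by have -> : (2 * v + 9 - 8) %/ 2 = v by lia.
Qed.

Lemma odd_directory_base n : odd (directory_base n) = false.
Proof. by rewrite /directory_base; lia. Qed.

Lemma memory_pointer ks b : let n := size ks in
  memory ks (2 * b + directory_base n) =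
  word_count n * word_size 16 n + block_offset ks (b * root4 n ^ 5).
Proof.
move=> n; rewrite /memory -/n oddD odd_directory_base.
have -> : (2 * b + directory_base n < 8) = false by rewrite /directory_base; lia.
have -> : (2 * b + directory_base n < directory_base n) = false by lia.
have -> : odd (2 * b) = false by lia.
by rewrite addnK mulKn.
Qed.

Lemma memory_relative ks b : let n := size ks in
  memory ks (2 * b + directory_base n).+1 = relative_offsets ks b.
Proof.
move=> n; rewrite /memory -/n /= oddD odd_directory_base.
have -> : ((2 * b + directory_base n).+1 < 8) = false by rewrite /directory_base; lia.
have -> : ((2 * b + directory_base n).+1 < directory_base n) = false by lia.
have -> : odd (2 * b) = false by lia.
by have -> : ((2 * b + directory_base n).+1 - directory_base n) %/ 2 = b by lia.
Qed.

Lemma stored_word_encode ks a : admissible ks -> a < word_count (size ks) ->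
  stored_word (word_size 16 (size ks)) (encode ks) a = memory ks a.
Proof. by move=> Hks ak; apply: stored_word_mem => //; apply: memory_lt. Qed.

Lemma size_encode ks :
  size (encode ks) = word_count (size ks) * word_size 16 (size ks)
                     + size (stream (max_level (size ks)) ks).
Proof. by rewrite size_cat size_mkseq. Qed.

Lemma size_encode_lt ks : admissible ks -> size (encode ks) < 2 ^ word_size 16 (size ks).
Proof.
move=> [n0 H1 _]; rewrite size_encode.
have := size_stream_le (max_level (size ks)) ks; have := bit_count_le n0.
have := word_bound (size ks); have := ltn_bitlen (size ks).
have : 2 ^ bitlen (size ks) <= (2 ^ bitlen (size ks)) ^ 2.
  by rewrite -[X in X <= _]expn1 leq_pexp2l ?expn_gt0.
lia.
Qed.

Lemma drop_encode ks t :
  drop (word_count (size ks) * word_size 16 (size ks) + block_offset ks t) (encode ks) =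
  stream (max_level (size ks)) (drop t ks).
Proof.
rewrite addnC -drop_drop drop_size_cat ?size_mkseq //.
exact: drop_stream.
Qed.

(** Invariant: the interval of item [i] lies inside the interval of the current node. Hence q_i <=
    2^-d' at the depth d' where the search ends, and the fallback is charged only to items with q_i
    <= 2^-D. *)
Lemma tree_search ks i C r6 r7 :
  admissible ks -> i < size ks ->
  let n := size ks in let S := total_weight ks in
  let D := tree_depth n in
  (2 ^ nth 0 ks i * 2 ^ D <= S -> forall v r6 r7,
    halts (word_size 16 n) (encode ks) query (C * D.+1) 17
      [:: i.+1; 1; 0; 2 ^ D; S; v; r6; r7; 8] (2 ^ nth 0 ks i, S, 0)) ->
  forall d u, u < 2 ^ d -> d <= D ->
  u * S <= weight_before ks i * 2 ^ d -> weight_before ks i.+1 * 2 ^ d <= u.+1 * S ->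
  exists d', [/\ d <= d', 2 ^ nth 0 ks i * 2 ^ d' <= S &
    halts (word_size 16 n) (encode ks) query (9 * (d' - d) + 9 + C * d'.+1) 5
      [:: i.+1; 1; 0; 2 ^ D; S; 2 ^ d + u; r6; r7; 8] (2 ^ nth 0 ks i, S, 0)].
Proof.
move=> Hks ik /=; set n := size ks; set S := total_weight ks; set D := tree_depth n.
set w := word_size 16 n => fallback d u ud /subnKC Ed; move: Ed ud.
have [n0 H1 H2] := Hks.
have XX : 2 ^ bitlen n <= (2 ^ bitlen n) ^ 2 by rewrite -[X in X <= _]expn1 leq_pexp2l ?expn_gt0.
have wb := word_bound n; have nL := ltn_bitlen n; have dn := expn_tree_depth_le n0.
have wc : directory_base n <= word_count n by apply: leq_addr.
rewrite -/w in wb; rewrite -/D in dn.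
move: (D - d) => e; elim: e d u r6 r7 => [|e IH] d u r6 r7 Ed ud lo hi.
  rewrite addn0 in Ed; have wD : 2 ^ nth 0 ks i * 2 ^ D <= S.
    by rewrite -Ed; move: hi; rewrite weight_before_S // mulnDl; lia.
  exists d; split=> //; first by rewrite Ed.
  apply: (@halts_leq _ _ _ (C * D.+1).+2); last by rewrite Ed; lia.
  exec; rewrite Ed ltnNge leq_addr /=; exec; exact: fallback.
have dD : d < D by lia.
have [jn lo' hi'] := splitterP n0 ud; move: jn lo' hi'; set j := splitter _ _ => jn lo' hi'.
have vD : 2 ^ d + u < 2 ^ D.
  by apply: (@leq_trans (2 ^ d.+1)); rewrite ?leq_exp2l // expnS; lia.
have K2 : 2 * (2 ^ d + u) + 10 < 2 ^ w by lia.
have K1 : 2 * (2 ^ d + u) + 9 < word_count n by move: wc; rewrite /directory_base -/D; lia.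
have Ez : stored_word w (encode ks) (2 * (2 ^ d + u) + 8) = j.+1.
  by rewrite stored_word_encode ?memory_splitter // -/n; apply: leq_ltn_trans K1; lia.
have Ey : stored_word w (encode ks) (2 * (2 ^ d + u) + 9) = 2 ^ nth 0 ks j.
  by rewrite stored_word_encode ?memory_weight.
(* The visit of node v up to the comparison: register 5 becomes 2v and register 6 the address 2v + 8
   of the entry of v. *)
have visit B : halts w (encode ks) query B 10
      [:: i.+1; 1; 0; 2 ^ D; S; 2 * (2 ^ d + u); 2 * (2 ^ d + u) + 8; j.+1; 8]
      (2 ^ nth 0 ks i, S, 0) ->
    halts w (encode ks) query B.+4 5
      [:: i.+1; 1; 0; 2 ^ D; S; 2 ^ d + u; r6; r7; 8] (2 ^ nth 0 ks i, S, 0).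
  move=> H; exec; rewrite vD; exec; rewrite eval_add addnn -mul2n; last by lia.
  by exec; rewrite eval_add; last lia; exec; rewrite Ez.
have Ed' : d.+1 + e = D by rewrite addSnnS.
(* An item other than the splitter misses the midpoint, hence lies in one half of the node: the
   child with index 2u or 2u + 1 at depth d + 1 inherits the invariant. *)
have [ij|ji|ij] := ltngtP i j.
- have u2 : 2 * u < 2 ^ d.+1 by rewrite expnS ltn_pmul2l.
  have lo2 : 2 * u * S <= weight_before ks i * 2 ^ d.+1.
    by move: lo; rewrite expnS; nia.
  have hi2 : weight_before ks i.+1 * 2 ^ d.+1 <= (2 * u).+1 * S.
    by rewrite -(addn1 (2 * u)); apply: leq_trans lo'; rewrite leq_mul2r leq_weight_before ?orbT.
  have [d' [dd' wd' H]] := IH d.+1 (2 * u) (2 * (2 ^ d + u) + 8) j.+1 Ed' u2 lo2 hi2.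
  exists d'; split=> //; first exact: ltnW.
  apply: (@halts_leq _ _ _ (9 * (d' - d.+1) + 9 + C * d'.+1).+2.+4); last by lia.
  apply: visit; exec; rewrite eqSS gtn_eqF //; exec; rewrite ltnS ij.
  by rewrite expnS -mulnDr in H.
- have u2 : (2 * u).+1 < 2 ^ d.+1 by rewrite expnS; lia.
  have lo2 : (2 * u).+1 * S <= weight_before ks i * 2 ^ d.+1.
    rewrite -(addn1 (2 * u)); apply: leq_trans (ltnW hi') _.
    by rewrite leq_mul2r leq_weight_before ?orbT.
  have hi2 : weight_before ks i.+1 * 2 ^ d.+1 <= (2 * u).+2 * S.
    by move: hi; rewrite expnS; nia.
  have [d' [dd' wd' H]] := IH d.+1 (2 * u).+1 (2 * (2 ^ d + u) + 8) j.+1 Ed' u2 lo2 hi2.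
  exists d'; split=> //; first exact: ltnW.
  apply: (@halts_leq _ _ _ (9 * (d' - d.+1) + 9 + C * d'.+1).+4.+4); last by lia.
  apply: visit; exec; rewrite eqSS ltn_eqF //; exec; rewrite ltnS ltnNge ltnW //=.
  exec; rewrite eval_add; last by lia.
  by exec; rewrite (addnS (2 ^ d.+1)) expnS -mulnDr in H; rewrite addn1.
exists d; split=> //.
  by move: hi; rewrite weight_before_S // mulnDl; lia.
apply: (@halts_leq _ _ _ 8); last by lia.
apply: visit; exec; rewrite ij eqxx; exec; rewrite eval_add; last by lia.
by exec; rewrite -addnA Ey; eapply halts_return; rewrite /= ?ij.
Qed.

Lemma level_le_max ks i : admissible ks ->
  2 ^ nth 0 ks i * 2 ^ tree_depth (size ks) <= total_weight ks ->
  nth 0 ks i <= max_level (size ks).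
Proof.
move=> [_ _ H2]; rewrite -expnD => H; have nL := ltn_bitlen (size ks).
have : nth 0 ks i + tree_depth (size ks) < bitlen (size ks) + 2.
  by rewrite -(@ltn_exp2l 2) // (expnD _ (bitlen _)); lia.
have := root4_gt0 (size ks); rewrite /tree_depth /bitlen /max_level; lia.
Qed.

(** Because 10s <= s^4 + 20, the subtracted 5s is at most [bitlen n] / 2 + 10; so an O(log n)
    fallback is O(D + 1). *)
Lemma bitlen_le_depth n : bitlen n <= 22 * (tree_depth n).+1.
Proof.
have : 10 * root4 n <= root4 n ^ 4 + 20.
  move: (root4 n) => [|[|[|s]]] //; rewrite !expnS expn0; nia.
have := root4_le n; rewrite /tree_depth -[trunc_log 2 n]/((bitlen n).-1) /bitlen; lia.
Qed.

Lemma fallback_search ks i v r6 r7 :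
  admissible ks -> i < size ks ->
  let n := size ks in let S := total_weight ks in
  2 ^ nth 0 ks i * 2 ^ tree_depth n <= S ->
  halts (word_size 16 n) (encode ks) query (2244 * (tree_depth n).+1) 17
      [:: i.+1; 1; 0; 2 ^ tree_depth n; S; v; r6; r7; 8] (2 ^ nth 0 ks i, S, 0).
Proof.
move=> Hks ik /=; set n := size ks; set S := total_weight ks; set D := tree_depth n.
set w := word_size 16 n => kD.
have kh := level_le_max Hks kD; rewrite -/n in kh.
have [n0 H1 H2] := Hks.
have XX : 2 ^ bitlen n <= (2 ^ bitlen n) ^ 2 by rewrite -[X in X <= _]expn1 leq_pexp2l ?expn_gt0.
have wb := word_bound n; have nL := ltn_bitlen n; have wc := word_count_le n0.
have ew := size_encode_lt Hks; rewrite -/n -/w in wb ew wc.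
set s := root4 n; have s0 : 0 < s := root4_gt0 n.
(* Block [J] and position [u] in it; superblock [b] and rank [j] of the block in it. *)
set J := i %/ s ^ 3; set u := i %% s ^ 3; set b := J %/ s ^ 2; set j := J %% s ^ 2.
have js : j < s ^ 2 by rewrite ltn_pmod // expn_gt0 s0.
have us : u < s ^ 3 by rewrite ltn_pmod // expn_gt0 s0.
have EJ : b * s ^ 5 + j * s ^ 3 = J * s ^ 3.
  by rewrite [J in RHS](divn_eq J (s ^ 2)) mulnDl -/b -/j -mulnA -expnD.
have Ei : i = J * s ^ 3 + u by apply: divn_eq.
have bn : b <= n %/ s ^ 5.
  by rewrite /b /J -divnMA -expnD leq_div2r // ltnW.
have bw : (2 * b + directory_base n).+1 < word_count n.
  by rewrite /word_count -/s; lia.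
have header_word k : k < 8 -> stored_word w (encode ks) (k %% 2 ^ w) = nth 0 (header ks) k.
  move=> k8; rewrite modn_small; last by lia.
  rewrite stored_word_encode //; last exact: leq_trans (header_words_lt _).
  by rewrite /memory k8.
have iw1 : i.+1 < 2 ^ w by lia.
have w2 : 2 < 2 ^ w by lia.
have w1 : 1 < 2 ^ w by exact: ltnW.
have iw : i < 2 ^ w by exact: ltnW.
have Jw : J < 2 ^ w by apply: leq_ltn_trans iw; apply: leq_div.
have bw2 : 2 * b + directory_base n + 1 < 2 ^ w by lia.
(* 28 instructions locate the block, and the scan adds at most s^3 (63s + 11) <= 74 s^4. As s^4 <=
   [bitlen n] <= 22 (D + 1), the total is at most 102 * 22 (D + 1). *)
apply: (@halts_leq _ _ _ (28 + u.+1 * (9 * max_level n + 11))); last first.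
  have := root4_le n; have := bitlen_le_depth n; rewrite -/D /max_level -/s => LD sL.
  apply: (@leq_trans (28 + s ^ 3 * (9 * (7 * s) + 11))).
    by rewrite leq_add2l leq_mul2r us orbT.
  have T0 : 0 < s ^ 3 by rewrite expn_gt0 s0.
  have TsT : s ^ 3 <= s * s ^ 3 by rewrite leq_pmull.
  by move: sL; rewrite (expnS s 3); lia.
exec; rewrite eval_sub // subn1 /=.
do 6 (exec; exec; rewrite header_word //=).
rewrite -/n -/s -/w.
exec; rewrite eval_mod // -/u; exec; rewrite eval_div // -/J; exec; rewrite eval_mod // -/j.
exec; rewrite eval_div // -/b.
exec; rewrite eval_add addnn -mul2n; last by lia.
exec; rewrite eval_add; last by lia.
exec; rewrite stored_word_encode // -?/n; last by lia.
rewrite memory_pointer -/n -/s -/w.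
exec; rewrite eval_add addn1; last by lia.
exec; rewrite stored_word_encode // memory_relative.
have rw := relative_offsets_lt ks b; rewrite -/n -/w in rw.
have digit := @relative_offsets_digit ks b j js; rewrite /= -/n -/s EJ in digit.
exec; rewrite eval_mul (mulnC j); last first.
  have := root4_le n; rewrite -/s (expnS s 3) /field_width -/s => sL.
  have : s * j <= s * s ^ 3 by rewrite leq_mul2l ltnW ?orbT // (leq_trans js) // leq_pexp2l.
  have : bitlen n < 2 ^ bitlen n by apply: ltn_expl.
  by rewrite -mulnA; clear - sL XX wb; lia.
exec; rewrite eval_shr //; exec; rewrite eval_mod; last by apply: leq_ltn_trans rw; apply: leq_div.
rewrite digit.
have off_le : block_offset ks (b * s ^ 5) <= block_offset ks (J * s ^ 3).
  by rewrite -EJ /block_offset offsetD leq_addr.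
have off_size : block_offset ks (J * s ^ 3) <= size (stream (max_level n) ks).
  by rewrite -[X in stream _ X](cat_take_drop (J * s ^ 3) ks) stream_cat size_cat leq_addr.
have pe : word_count n * w + block_offset ks (J * s ^ 3) <= size (encode ks).
  by rewrite size_encode leq_add2l.
exec; rewrite eval_add -addnA subnKC //; last exact: leq_ltn_trans pe ew.
exec; rewrite [1 %% _]modn_small //.
exec; rewrite [2 %% _]modn_small //.
(* By [kh] the level does not exceed the cut, so its truncated code is exact. *)
have -> : 2 ^ nth 0 ks i = 2 ^ minn (nth 0 (drop (J * s ^ 3) ks) u) (max_level n).
  by rewrite nth_drop -Ei (minn_idPl kh).
have w0 : 0 < w by rewrite /w /word_size muln_gt0.
have hw : max_level n < w.
  have := root4_le n; rewrite -/s (expnS s 3) /max_level /w /word_size -/(bitlen n) -/s.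
  have : s * 1 <= s * s ^ 3 by rewrite leq_mul2l expn_gt0 s0 orbT.
  by rewrite muln1; clear - s0; lia.
have uw : u < 2 ^ w by apply: leq_ltn_trans iw; rewrite Ei leq_addl.
have ud : u < size (drop (J * s ^ 3) ks) by rewrite size_drop ltn_subRL -Ei.
exact: (decode_stream _ _ _ _ _ _ _ _ _ _ w0 w1 ew hw pe (drop_encode _ _) ud uw).
Qed.

(** A single depth [d] controls both the time and q_i <= 2^-d. With five steps of initialization, 5
    + 9d + 9 + 2244 (d + 1) <= 2258 (d + 1). *)
Lemma query_correct ks i : admissible ks -> i < size ks ->
  exists d, 2 ^ nth 0 ks i * 2 ^ d <= total_weight ks /\
    exists2 t, t <= 2258 * d.+1 &
      run (word_size 16 (size ks)) (encode ks) query t 0 (set_reg (fun=> 0) 0 i.+1)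
      = Some (2 ^ nth 0 ks i, total_weight ks, 0).
Proof.
move=> Hks ik; have := @tree_search ks i 2244 0 0 Hks ik.
set n := size ks; set S := total_weight ks; set w := word_size 16 n => /= tree.
have fb kD v r6 r7 := fallback_search v r6 r7 Hks ik kD.
have hi : weight_before ks i.+1 * 2 ^ 0 <= 1 * S.
  by rewrite mul1n muln1 /S -weight_before_size leq_weight_before.
have [d [_ wd H]] := tree fb 0 0 isT (leq0n _) isT hi.
exists d; split=> //; have [n0 H1 H2] := Hks.
have -> : set_reg (fun=> 0) 0 i.+1 = nth 0 [:: i.+1].
  by apply/funext => [[|[|x]]].
apply: (@halts_leq _ _ _ (9 * (d - 0) + 9 + 2244 * d.+1).+4.+1); last by lia.
have wb := word_bound n.
have X0 : 0 < (2 ^ bitlen n) ^ 2 by rewrite !expn_gt0.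
have w8 : 8 < 2 ^ w by rewrite /w; lia.
have header_word k : k < 8 -> stored_word w (encode ks) k = nth 0 (header ks) k.
  move=> k8; rewrite stored_word_encode //; last exact: leq_trans (header_words_lt _).
  by rewrite /memory k8.
exec; rewrite modn_small; last by lia.
exec; rewrite header_word //=; exec; rewrite header_word //=.
exec; rewrite modn_small; last by lia.
exec; rewrite modn_small; last by lia.
exact: H.
Qed.

(** * Space beyond the unary codes *)

Lemma expn_tree_depth_le_div n : 0 < n -> 2 ^ tree_depth n <= (n %/ root4 n ^ 5).+1.
Proof.
move=> n0; have [|t5] := leqP (trunc_log 2 n) (5 * root4 n).
  by rewrite -subn_eq0 -/(tree_depth n) => /eqP ->.
apply/leqW; rewrite leq_divRL ?expn_gt0 ?root4_gt0 //.
apply: leq_trans (trunc_logP (ltnSn 1) n0); rewrite -(subnK (ltnW t5)) expnD leq_mul2l.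
by rewrite mulnC expnM leq_exp2r // ltnW ?orbT // ltn_expl.
Qed.

Lemma sqr_bitlen_le n : 0 < n -> bitlen n ^ 2 <= 4 * n.
Proof.
move=> n0; apply: leq_trans (_ : 4 * 2 ^ trunc_log 2 n <= _).
  rewrite /bitlen; elim: (trunc_log 2 n) => // -[//|[//|t]] IH.
  by rewrite (expnS 2 t.+2); move: (2 ^ t.+2) IH => E; rewrite -!mulnn; nia.
by rewrite leq_mul2l trunc_logP.
Qed.

(** There are at most 12 + 4 (n / s^5) words of at most 256 s^4 bits; after multiplication by s this
    is O(s^5) + O(n). *)
Lemma redundancy_bound n : 0 < n ->
  word_count n * word_size 16 n * root4 n <= 256 * 52 * n.
Proof.
move=> n0; rewrite /word_size -/(bitlen n) /word_count /directory_base.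
have := expn_tree_depth_le_div n0; have := sqr_bitlen_le n0.
have := leq_divM n (root4 n ^ 5).
have := root4_gt n; have := root4_le n; have := root4_gt0 n.
move: (root4 n) (bitlen n) (n %/ root4 n ^ 5) (2 ^ tree_depth n) => s L q d s0 s4 Ls qn Ln dq.
have s1 : s <= s ^ 4 by rewrite -[X in X <= _]expn1 leq_pexp2l.
(* Absorbs the constant number of words: s^5 <= s^8 <= L^2 <= 4n. *)
have s5 : s ^ 5 <= 4 * n.
  by apply: leq_trans Ln; rewrite expnSr -mulnn leq_mul // (leq_trans s1).
apply: (@leq_trans ((12 + 4 * q) * (16 * (16 * s ^ 4)) * s)).
  rewrite leq_mul2r; apply/orP; right; apply: leq_mul; first by lia.
  by rewrite leq_mul2l ltnW.
have -> : (12 + 4 * q) * (16 * (16 * s ^ 4)) * s = 256 * (12 * s ^ 5 + 4 * (q * s ^ 5)).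
  by rewrite (expnSr s 4); move: (s ^ 4) => T; ring.
by lia.
Qed.

Lemma root4_unbounded M n : 2 ^ (16 * M ^ 4) <= n -> M < root4 n.
Proof.
move=> Mn; rewrite -(@ltn_exp2r _ _ 4) // -(@ltn_pmul2l 16) //.
by apply: leq_ltn_trans (root4_gt n); rewrite leqW // trunc_log_max.
Qed.

Lemma weight_others ks i : i < size ks ->
  2 ^ nth 0 ks i + (size ks).-1 <= total_weight ks.
Proof.
rewrite /total_weight; elim: ks i => [|k ks IH] [|i] //= ik; rewrite big_cons.
  by rewrite leq_add2l size_leq_total_weight.
by have := IH i ik; have := expn_gt0 2 k; lia.
Qed.

(** The other n - 1 >= n / 2 items weigh at least 1 each, together at least a sixth of S <= 3n. So
    log (1 / q_i) stays away from 0 and can absorb additive constants. *)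
Lemma weight_le_five_sixths ks i : admissible ks -> 1 < size ks -> i < size ks ->
  6 * 2 ^ nth 0 ks i <= 5 * total_weight ks.
Proof. by move=> [_ _ H] n1 /weight_others; lia. Qed.

Local Open Scope ring_scope.

Lemma sublinear_redundancy (R : realType) :
  sublinear R (fun n => (word_count n * word_size 16 n)%N).
Proof.
apply/cvgrPdist_lt => e e0.
(* By [redundancy_bound] the ratio is at most 256 * 52 / s, so s > M suffices. *)
have [M HM] : exists M : nat, 256 * 52 / e < M%:R.
  by exists (Num.truncn (256 * 52 / e)).+1; exact: truncnS_gt.
exists (2 ^ (16 * M ^ 4))%N => // n /= Mn.
have n0 : (0 < n)%N by apply: leq_trans Mn; rewrite expn_gt0.
have Ms := root4_unbounded Mn; have rb := redundancy_bound n0.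
rewrite sub0r normrN ger0_norm ?divr_ge0 // ltr_pdivrMr ?ltr0n //.
have s0 : (0 : R) < (root4 n)%:R by rewrite ltr0n root4_gt0.
rewrite -(ltr_pM2r s0) -natrM; apply: le_lt_trans (_ : 256 * 52 * n%:R < _).
  by rewrite -!natrM ler_nat.
rewrite [e * _ * _]mulrAC ltr_pM2r ?ltr0n //; rewrite ltr_pdivrMr // in HM.
by apply: lt_trans HM _; rewrite mulrC ltr_pM2l // ltr_nat.
Qed.

(** * The distribution *)

Definition level (R : realType) (x : R) : nat :=
  if Num.truncn x is m.+1 then (trunc_log 2 m.+1).+1 else 0%N.

(** For m >= 1 and t = floor(log2 m), t + 1 <= 2^t <= m. *)
Lemma level_le (R : realType) (x : R) : 0 <= x -> (level x)%:R <= x.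
Proof.
move=> x0; have /andP[mx _] := truncn_itv x0; apply: le_trans mx; rewrite ler_nat /level.
case: Num.truncn => // m; apply: leq_trans (trunc_logP (ltnSn 1) (ltn0Sn m)).
exact: ltn_expl.
Qed.

Lemma weight_level_le (R : realType) (x : R) : 0 <= x -> (2 ^ level x)%:R <= 2 * x + 1.
Proof.
move=> x0; have /andP[mx _] := truncn_itv x0.
apply: (@le_trans _ _ (2 * (Num.truncn x)%:R + 1)); last by lra.
rewrite -natrM natr1 ler_nat /level.
case: Num.truncn => // m; rewrite expnS leqW // leq_mul2l.
exact: (trunc_logP (ltnSn 1) (ltn0Sn m)).
Qed.

Lemma lt_weight_level (R : realType) (x : R) : 0 <= x -> x < (2 ^ level x)%:R.
Proof.
move=> x0; have /andP[_ xm] := truncn_itv x0; apply: lt_le_trans xm _; rewrite ler_nat /level.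
by case: Num.truncn => // m; apply: trunc_log_ltn.
Qed.

Definition levels (R : realType) (n : nat) (P : pdistr R n) : seq nat :=
  [seq level (n%:R * P i) | i <- enum 'I_n].

Lemma size_levels (R : realType) (n : nat) (P : pdistr R n) : size (levels P) = n.
Proof. by rewrite size_map size_enum_ord. Qed.

Lemma nth_levels (R : realType) (n : nat) (P : pdistr R n) (i : 'I_n) :
  nth 0%N (levels P) i = level (n%:R * P i).
Proof. by rewrite (nth_map i) ?size_enum_ord // nth_ord_enum. Qed.

Lemma pdistr_gt0 (R : realType) (n : nat) (P : pdistr R n) : (0 < n)%N.
Proof.
case: n P => // P; have := prob_sum1 P; rewrite big_ord0 => /eqP.
by rewrite eq_sym oner_eq0.
Qed.

Lemma total_weight_levels (R : realType) (n : nat) (P : pdistr R n) :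
  total_weight (levels P) = (\sum_(i < n) 2 ^ level (n%:R * P i))%N.
Proof. by rewrite /total_weight big_map big_enum. Qed.

(** Summing k_i + 1 <= x_i + 1 and 2^k_i <= 2 x_i + 1, where the x_i add up to n, gives 2n and
    3n. *)
Lemma admissible_levels (R : realType) (n : nat) (P : pdistr R n) : admissible (levels P).
Proof.
have x0 i : 0 <= n%:R * P i by rewrite mulr_ge0 ?prob_ge0.
have sumx : \sum_(i < n) (n%:R * P i) = n%:R :> R.
  by rewrite -big_distrr /= prob_sum1 mulr1.
split; rewrite ?size_levels ?(pdistr_gt0 P) //.
  rewrite /levels big_map big_enum /= -(ler_nat R) natr_sum.
  apply: le_trans (_ : \sum_(i < n) (n%:R * P i + 1) <= _).
    by apply: ler_sum => i _; rewrite -natr1 lerD2r level_le.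
  rewrite big_split /= sumx sumr_const card_ord natrM; lra.
rewrite total_weight_levels -(ler_nat R) natr_sum.
apply: le_trans (_ : \sum_(i < n) (2 * (n%:R * P i) + 1) <= _).
  by apply: ler_sum => i _; rewrite weight_level_le.
rewrite big_split /= -big_distrr /= sumx sumr_const card_ord natrM; lra.
Qed.

Lemma total_weight_levels_gt0 (R : realType) (n : nat) (P : pdistr R n) :
  (0 : R) < (total_weight (levels P))%:R.
Proof.
rewrite ltr0n; apply: leq_trans (size_leq_total_weight _).
by rewrite size_levels (pdistr_gt0 P).
Qed.

Definition rounded_prob (R : realType) (n : nat) (P : pdistr R n) (i : 'I_n) : R :=
  (2 ^ level (n%:R * P i))%:R / (total_weight (levels P))%:R.

Lemma rounded_prob_gt0 (R : realType) (n : nat) (P : pdistr R n) i : 0 < rounded_prob P i.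
Proof. by rewrite divr_gt0 ?total_weight_levels_gt0 // ltr0n expn_gt0. Qed.

Lemma rounded_prob_ge0 (R : realType) (n : nat) (P : pdistr R n) i : 0 <= rounded_prob P i.
Proof. exact/ltW/rounded_prob_gt0. Qed.

Lemma rounded_prob_sum1 (R : realType) (n : nat) (P : pdistr R n) :
  \sum_(i < n) rounded_prob P i = 1.
Proof.
rewrite -big_distrl /= -natr_sum -total_weight_levels divff //.
by rewrite gt_eqF // total_weight_levels_gt0.
Qed.

Definition rounded (R : realType) (n : nat) (P : pdistr R n) : pdistr R n :=
  PDistr (rounded_prob_ge0 P) (rounded_prob_sum1 P).

(** From S <= 3n and n p_i < 2^k_i, S p_i <= 3 n p_i < 3 * 2^k_i. *)
Lemma prob_lt_rounded (R : realType) (n : nat) (P : pdistr R n) i :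
  P i < 3 * rounded P i.
Proof.
have n0 := pdistr_gt0 P; have x0 : 0 <= n%:R * P i by rewrite mulr_ge0 ?prob_ge0.
have [_ _] := admissible_levels P; rewrite size_levels -(ler_nat R) natrM => S3.
rewrite /= /rounded_prob mulrA ltr_pdivlMr ?total_weight_levels_gt0 //.
apply: le_lt_trans (_ : 3 * (n%:R * P i) < _); last by rewrite ltr_pM2l // lt_weight_level.
by rewrite mulrA mulrC ler_wpM2r ?prob_ge0.
Qed.

Lemma prob_le1 (R : realType) (n : nat) (P : pdistr R n) i : P i <= 1.
Proof.
by rewrite -(prob_sum1 P) (bigD1 i) //= lerDl sumr_ge0 // => j _; apply: prob_ge0.
Qed.

Lemma ratio_lt (R : realType) (n : nat) (P : pdistr R n) i : P i / rounded P i < 3.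
Proof. by rewrite ltr_pdivrMr ?rounded_prob_gt0 // prob_lt_rounded. Qed.

(** * Logarithms and relative entropy *)

Lemma ln2_gt0 (R : realType) : 0 < ln (2 : R).
Proof. by rewrite ln_gt0 // ltr1n. Qed.

Lemma le_log2 (R : realType) (x y : R) : 0 < x -> x <= y -> log2 x <= log2 y.
Proof.
move=> x0 xy; rewrite ler_pM2r ?invr_gt0 ?ln2_gt0 // ler_ln ?posrE //.
exact: lt_le_trans xy.
Qed.

Lemma log2X (R : realType) (d : nat) : log2 (2 ^+ d : R) = d%:R.
Proof.
by rewrite /log2 lnXn // -[ln 2 *+ d]mulr_natl mulfK // gt_eqF // ln2_gt0.
Qed.

Lemma log2_gt0 (R : realType) (x : R) : 1 < x -> 0 < log2 x.
Proof. by move=> x1; rewrite divr_gt0 ?ln2_gt0 ?ln_gt0. Qed.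

Lemma log2M (R : realType) (x y : R) : 0 < x -> 0 < y -> log2 (x * y) = log2 x + log2 y.
Proof. by move=> x0 y0; rewrite /log2 lnM ?posrE // mulrDl. Qed.

(** Each term is at most p_i log 3, and log 3 < log 4 = 2. *)
Lemma relative_entropy_lt2 (R : realType) (n : nat) (P : pdistr R n) :
  relative_entropy P (rounded P) < 2.
Proof.
apply: (@le_lt_trans _ _ (\sum_(i < n) P i * log2 3)).
  apply: ler_sum => i _; have := prob_ge0 P i; rewrite le_eqVlt => /predU1P[<-|p0].
    by rewrite !mul0r.
  rewrite ler_wpM2l ?prob_ge0 //; apply: le_log2 (ltW (ratio_lt P i)).
  by rewrite divr_gt0 ?rounded_prob_gt0.
rewrite -big_distrl /= prob_sum1 mul1r -(log2X R 2) /log2.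
by rewrite ltr_pM2r ?invr_gt0 ?ln2_gt0 // ltr_ln ?posrE // -natrX ltr_nat.
Qed.

Lemma rounded_answers (R : realType) (n : nat) (P : pdistr R n) (i : 'I_n) :
  exists t : nat, answers (word_size 16 n) (encode (levels P)) query i.+1 t (rounded P i) /\
    exists2 d : nat, (t <= 2258 * d.+1)%N & rounded P i <= (2 ^+ d)^-1.
Proof.
have Hk := admissible_levels P; have ik : (i < size (levels P))%N by rewrite size_levels.
have [d [wd [t tB Ht]]] := query_correct Hk ik.
rewrite size_levels nth_levels in Ht wd; exists t; split.
  by do 3 eexists; split; [exact: Ht | rewrite expr0 divr1].
exists d => //=; rewrite /rounded_prob ler_pdivrMr ?total_weight_levels_gt0 //.
rewrite [X in _ <= X]mulrC ler_pdivlMr ?exprn_gt0 //.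
by rewrite -natrX -natrM ler_nat.
Qed.

Lemma rounded_le (R : realType) (n : nat) (P : pdistr R n) (i : 'I_n) :
  (1 < n)%N -> 6 / 5 <= (rounded P i)^-1.
Proof.
move=> n1; rewrite /= /rounded_prob invf_div ler_pdivlMr ?ltr0n ?expn_gt0 //.
have := @weight_le_five_sixths (levels P) i (admissible_levels P).
rewrite size_levels => /(_ n1 (ltn_ord i)); rewrite nth_levels -(ler_nat R) !natrM; lra.
Qed.

(** * Running time against log (1 / q_i) *)

Definition query_time (R : realType) (n : nat) (P : pdistr R n) (i : 'I_n) : nat :=
  sval (cid (rounded_answers P i)).

Lemma log2_inv_gt0 (R : realType) (x : R) : 0 < x -> log2_inv x = (log2 x^-1)%:E.
Proof. by move=> x0; rewrite /log2_inv gt_eqF. Qed.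

(** Both d <= log (1 / q_i) and, by [rounded_le], 1 <= log (1 / q_i) / log (6 / 5), so 2258 (d + 1)
    is linear in log (1 / q_i). *)
Lemma query_time_Oset (R : realType) :
  Oset (fun n (P : pdistr R n) i => log2_inv (rounded P i))
       (fun n (P : pdistr R n) i => (query_time P i)%:R).
Proof.
have c0 : 0 < log2 (6 / 5 : R) by apply: log2_gt0; lra.
exists (2258%:R * (1 + (log2 (6 / 5 : R))^-1)).
  by apply: mulr_gt0; rewrite ?ltr0n ?addr_gt0 ?invr_gt0.
move=> n P i n1; have q0 := rounded_prob_gt0 P i.
rewrite log2_inv_gt0 // -EFinM lee_fin.
rewrite /query_time; case: cid => t [_ [d td qd]] /=.
have ld : d%:R <= log2 (rounded P i)^-1.
  rewrite -(log2X R d) le_log2 ?exprn_gt0 //.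
  by rewrite -[2 ^+ d]invrK lef_pV2 // posrE invr_gt0 exprn_gt0.
have lc : log2 (6 / 5 : R) <= log2 (rounded P i)^-1.
  by rewrite le_log2 ?rounded_le //; lra.
rewrite -(ler_nat R) in td; apply: le_trans td _.
rewrite natrM -mulrA ler_wpM2l ?ler0n // -addn1 natrD addrC mulrDl mul1r addrC lerD //.
by rewrite mulrC ler_pdivlMr // mul1r.
Qed.

(** As q_i > p_i / 4, log (1 / q_i) <= 2 + log (1 / p_i) <= 2 (1 + log (1 / p_i)). The summand 1
    matters when p_i = 1: then log (1 / p_i) = 0, whereas q_i <= 5/6. *)
Lemma Oset_rounded_subset (R : realType) :
  (Oset (fun n (P : pdistr R n) i => log2_inv (rounded P i))
     `<=` Oset (fun n (P : pdistr R n) i => (1 + log2_inv (P i))%E))%classic.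
Proof.
move=> f [C C0 HC]; exists (2 * C); first by rewrite mulr_gt0.
move=> n P i n1; apply: le_trans (HC n P i n1) _.
have q0 := rounded_prob_gt0 P i; rewrite log2_inv_gt0 //.
(* For p_i = 0 the right-hand side is +oo. *)
have := prob_ge0 P i; rewrite le_eqVlt => /predU1P[<-|p0].
  by rewrite /log2_inv eqxx addey // gt0_muley ?leey // lte_fin mulr_gt0.
rewrite log2_inv_gt0 // -EFinD -!EFinM lee_fin mulrAC -[X in _ <= X]mulrC ler_wpM2l ?(ltW C0) //.
have lp : 0 <= log2 (P i)^-1.
  apply: divr_ge0; last exact/ltW/ln2_gt0.
  by rewrite ln_ge0 // invf_ge1 // prob_le1.
have : log2 (rounded P i)^-1 <= log2 (2 ^+ 2 * (P i)^-1).
  apply: le_log2; first by rewrite invr_gt0.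
  rewrite -[2 ^+ 2]invrK -invfM lef_pV2 ?posrE //; last by rewrite mulr_gt0 ?invr_gt0.
  have := prob_lt_rounded P i; rewrite -natrX; lra.
rewrite log2M ?invr_gt0 ?exprn_gt0 // log2X; lra.
Qed.

(* [enc n P] is the data structure for P, [Q n P] the distribution Q, and
   [T n P i] the number of steps of the query for the (i+1)-st probability,
   the indices i : 'I_n being 0-based. *)
Theorem theorem5 (R : realType) :
  exists (c : nat) (query : program)
         (enc : forall n : nat, pdistr R n -> seq bool)
         (Q : forall n : nat, pdistr R n -> pdistr R n)
         (T : forall n : nat, pdistr R n -> 'I_n -> nat)
         (redundancy : nat -> nat),
    [/\ (0 < c)%N,
        sublinear R redundancy
          /\ (forall (n : nat) (P : pdistr R n),
                (size (enc n P) <= 2 * n + redundancy n)%N),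
        (forall (n : nat) (P : pdistr R n) (i : 'I_n),
            answers (word_size c n) (enc n P) query i.+1 (T n P i) (Q n P i))
          /\ Oset (fun n P i => log2_inv (Q n P i))
                  (fun n P i => (T n P i)%:R),
        (forall (n : nat) (P : pdistr R n),
            [/\ forall i : 'I_n, 0 < Q n P i,
                \big[Num.max/0]_(i < n) (P i / Q n P i) < 4
              & relative_entropy P (Q n P) < 2])
      & (Oset (fun n P i => log2_inv (Q n P i))
           `<=` Oset (fun n P i => (1 + log2_inv (P i))%E))%classic].
Proof.
exists 16%N, query, (fun n P => encode (levels P)), (@rounded R), (@query_time R),
  (fun n => (word_count n * word_size 16 n)%N); split=> //.
- split=> [|n P]; first exact: sublinear_redundancy.
  (* The stored words are the redundancy; the unary codes take at most 2n bits. *)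
  rewrite size_encode size_levels addnC leq_add2r.
  have [_ H _] := admissible_levels P; rewrite size_levels in H.
  exact: leq_trans (size_stream_le _ _) H.
- split=> [n P i|]; last exact: query_time_Oset.
  by rewrite /query_time; case: cid => t [].
- move=> n P; split; [exact: rounded_prob_gt0 | | exact: relative_entropy_lt2].
  by apply: bigmax_lt => // i _; apply: lt_trans (ratio_lt P i) _; rewrite ltr_nat.
- exact: Oset_rounded_subset.
Qed.
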